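(* Let $\Lambda:\Delta\to\mathbb{R}\cup\{\infty\}$ be a convex regularizer (not identically $+\infty$) defining a perturbed utility model, with surplus function $\Omega(\mathbf{V})=\sup_{\mathbf{q}\in\Delta}\{\mathbf{q}^\top\mathbf{V}-\Lambda(\mathbf{q})\}$, $\mathbf{V}\in\mathbb{R}^K$. Given observations $n=1,\dots,N$ with attribute vectors $\mathbf{x}_{n1},\dots,\mathbf{x}_{nK}\in\mathbb{R}^d$ and one-hot choices $\mathbf{y}_n\in\{0,1\}^K$, let $\mathbf{V}_n(\boldsymbol{\beta})=(\boldsymbol{\beta}^\top\mathbf{x}_{n1},\dots,\boldsymbol{\beta}^\top\mathbf{x}_{nK})^\top$. Then the Fenchel--Young estimation problem $$\min_{\boldsymbol{\beta}\in\mathbb{R}^d}\ \mathcal{J}(\boldsymbol{\beta})=\frac1N\sum_{n=1}^N\Big(\Omega(\mathbf{V}_n(\boldsymbol{\beta}))-\mathbf{y}_n^\top\mathbf{V}_n(\boldsymbol{\beta})\Big)$$ is a convex optimization problem, i.e. $\mathcal{J}$ is a convex function on $\mathbb{R}^d$.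
   Context: $\Delta=\{\mathbf{q}\in\mathbb{R}^K:\mathbf{q}\ge 0,\ \sum_i q_i=1\}$ is the probability simplex. In a perturbed utility model the choice probability vector at utility vector $\mathbf{V}$ maximizes $\mathbf{q}^\top\mathbf{V}-\Lambda(\mathbf{q})$ over $\mathbf{q}\in\Delta$. *)

(* Defs.v *)
From HB Require Import structures.
From mathcomp Require Import all_boot all_order all_algebra.
From mathcomp Require Import boolp classical_sets interval_inference.
From mathcomp Require Import reals ereal convex.

Set Implicit Arguments.
Unset Strict Implicit.
Unset Printing Implicit Defensive.

Import Order.TTheory GRing.Theory Num.Theory.

Local Open Scope classical_set_scope.
Local Open Scope ring_scope.
Local Open Scope convex_scope.

Definition dot (R : realType) (m : nat) (u v : 'cV[R]_m) : R :=
  (u^T *m v) 0 0.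

Definition simplex (R : realType) (K : nat) : set 'cV[R]_K :=
  [set q | (forall i, 0 <= q i 0) /\ \sum_(i < K) q i 0 = 1].

(** Extended-real counterpart of [convex_function].  It is meant for [f] without
    the value [-oo] on [D]; since [0 * +oo = 0], the cases [t = 0] and [t = 1]
    hold trivially. *)
Definition convex_function_ereal (R : realType) (E : lmodType R)
    (E' := convex_lmodType E) (D : set E') (f : E' -> \bar R) :=
  forall t : {i01 R}, {in D &, forall x y : E',
    (f (x <| t |> y) <= (t%:num)%:E * f x + (1 - t%:num)%:E * f y)%E}.

(** A convex map from the simplex to the reals extended by [+oo], not identically
    [+oo].  The values of [Lambda] outside the simplex are irrelevant. *)
Definition convex_regularizer (R : realType) (K : nat)
    (Lambda : 'cV[R]_K -> \bar R) : Prop :=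
  [/\ forall q, simplex q -> Lambda q != -oo%E,
      exists2 q, simplex q & Lambda q != +oo%E
    & convex_function_ereal (@simplex R K) Lambda].

Definition surplus (R : realType) (K : nat) (Lambda : 'cV[R]_K -> \bar R)
    (V : 'cV[R]_K) : \bar R :=
  ereal_sup [set ((dot q V)%:E - Lambda q)%E | q in @simplex R K].

Definition one_hot (R : realType) (K : nat) (y : 'cV[R]_K) : Prop :=
  exists k : 'I_K, y = delta_mx k 0.

Definition utility (R : realType) (d K : nat) (x : 'I_K -> 'cV[R]_d)
    (beta : 'cV[R]_d) : 'cV[R]_K :=
  \col_(k < K) dot beta (x k).

Definition FY_objective (R : realType) (d K N : nat)
    (Lambda : 'cV[R]_K -> \bar R) (x : 'I_N -> 'I_K -> 'cV[R]_d)
    (y : 'I_N -> 'cV[R]_K) (beta : 'cV[R]_d) : \bar R :=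
  ((N%:R^-1)%:E * \sum_(n < N)
     (surplus Lambda (utility (x n) beta)
      - (dot (y n) (utility (x n) beta))%:E))%E.

(* Main.v *)
Require Import Defs.
From HB Require Import structures.
From mathcomp Require Import all_boot all_order all_algebra.
From mathcomp Require Import boolp classical_sets interval_inference.
From mathcomp Require Import reals ereal convex.
From mathcomp Require Import ring lra.

Set Implicit Arguments.
Unset Strict Implicit.
Unset Printing Implicit Defensive.

Import Order.TTheory GRing.Theory Num.Theory.

Local Open Scope classical_set_scope.
Local Open Scope ring_scope.

(** Convexity of the objective is the usual remark that a supremum of affine
    functions is convex: [Omega] is the supremum of the maps
    [V |-> q^T V - Lambda q], the utilities are linear in [beta], and [J] is
    an average of compositions of the two plus linear terms.

    The part that needs work is that [Omega] is finite everywhere. It is not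
    [-oo] because [Lambda] is finite somewhere. It is not [+oo] because
    [Lambda] is bounded below on the simplex ([convex_bounded_below]). As
    [Lambda] may fail to be lower semicontinuous, compactness of the simplex
    does not give this bound: it has to come from convexity. Let [C] be the
    set where [Lambda] is finite. Choose finitely many points of [C] with the
    same linear span as [C] ([spanning_points]), and let [c] be their
    barycenter. Every point [q] of [C] is a linear combination of these
    points, with coefficients that are bounded independently of [q], and that
    have sum [1] because all points lie in the hyperplane of entry sum [1].
    Hence, for a small weight [t] that does not depend on [q], [c] can be
    written as [t q + (1 - t) r] with [r] a genuine convex combination of the
    chosen points. On such [r], [Lambda] is bounded above by its values at the
    chosen points, and [Lambda c <= t Lambda q + (1 - t) Lambda r] then bounds
    [Lambda q] from below. *)

(** * Lower bounds for convex functions on subsets of the simplex *)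

(** The [m] points are chosen so that the rank of the matrix with these columns
    is the largest possible: adding one more point of [C] cannot increase it.
    The coordinates are given by a matrix [L], so that they depend linearly on
    the point and are bounded when the point is. *)
Lemma spanning_points (F : fieldType) (n : nat) (C : set 'cV[F]_n) :
  exists m (P : 'M[F]_(n, m)) (L : 'M[F]_(m, n)),
    (forall i, C (col i P)) /\ (forall q, C q -> P *m (L *m q) = q).
Proof.
pose attained r := `[< exists m (P : 'M[F]_(m, n)),
  (forall i, C (row i P)^T) /\ \rank P = r >].
have attained0 : exists r, attained r.
  exists 0%N; apply/asboolP; exists 0%N, 0; split; first by case.
  by rewrite mxrank0.
have attained_le r : attained r -> (r <= n)%N.
  by move=> /asboolP[m [P [_ <-]]]; exact: rank_leq_col.
case: (ex_maxnP attained0 attained_le) => _ /asboolP[m [P [CP <-]]] Pmax.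
exists m, P^T, (pinvmx P)^T; split=> [i|q Cq]; first by rewrite -tr_row.
have qP : (q^T <= P)%MS.
  suff : (col_mx P q^T <= P)%MS by rewrite col_mx_sub => /andP[].
  have PPq : (P <= col_mx P q^T)%MS by rewrite -addsmxE addsmxSl.
  rewrite -(mxrank_leqif_sup PPq) eqn_leq mxrankS //=.
  apply: Pmax; apply/asboolP; exists (m + 1)%N, (col_mx P q^T); split=> // i.
  case: (split_ordP i) => j ->; first by rewrite rowKu; exact: CP.
  by rewrite rowKd [j]ord1 row_id trmxK.
by rewrite -[q in LHS]trmxK -!trmx_mul mulmxKpV // trmxK.
Qed.

(** Homogeneous form of the stability of convex sets under convex combinations:
    leaving the total weight unnormalized makes the two sides additive, and
    covers total weight [0]. *)
Lemma conic_combination (R : realFieldType) (n m : nat) (C : set 'cV[R]_n)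
    (c0 : 'cV[R]_n) (P : 'M[R]_(n, m)) (b : 'cV[R]_m) :
    (forall t a a', 0 <= t <= 1 -> C a -> C a' -> C (t *: a + (1 - t) *: a')) ->
    C c0 -> (forall i, C (col i P)) -> (forall i, 0 <= b i 0) ->
  exists2 r, C r & P *m b = (\sum_i b i 0) *: r.
Proof.
move=> Cconv Cc0 CP b_ge0.
have -> : P *m b = \sum_i b i 0 *: col i P.
  apply/colP => j; rewrite summxE mxE; apply: eq_bigr => i _.
  by rewrite !mxE mulrC.
pose in_cone (v : 'cV[R]_n) (s : R) := 0 <= s /\ exists2 r, C r & v = s *: r.
suff [] : in_cone (\sum_i b i 0 *: col i P) (\sum_i b i 0) by [].
apply: (big_ind2 in_cone) => [|v s w u [s0 [r Cr ->]] [u0 [r' Cr' ->]]|i _].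
- by split=> //; exists c0 => //; rewrite scale0r.
- split; first exact: addr_ge0.
  have [su0|su_neq0] := eqVneq (s + u) 0.
    move: su0 => /eqP; rewrite paddr_eq0 // => /andP[/eqP-> /eqP->].
    by exists c0 => //; rewrite !scale0r !addr0 scale0r.
  exists (s / (s + u) *: r + (1 - s / (s + u)) *: r').
    apply: Cconv => //; rewrite divr_ge0 ?addr_ge0 //=.
    by rewrite ler_pdivrMr ?mul1r ?lerDl // lt_def su_neq0 addr_ge0.
  by rewrite scalerDr !scalerA; congr (_ *: _ + _ *: _); field.
- by split=> //; exists (col i P).
Qed.

(** Multiplication by a matrix whose columns have sum [1] preserves the sum of
    the entries. *)
Lemma sum_mulmx_col1 (R : comPzRingType) (n m : nat) (P : 'M[R]_(n, m))
    (a : 'cV[R]_m) :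
  (forall i, \sum_j P j i = 1) -> \sum_j (P *m a) j 0 = \sum_i a i 0.
Proof.
move=> P1; under eq_bigr do rewrite mxE.
by rewrite exchange_big; apply: eq_bigr => i _; rewrite -mulr_suml P1 mul1r.
Qed.

Lemma simplex_norm_le1 (R : realType) (K : nat) (q : 'cV[R]_K) i :
  simplex q -> `|q i 0| <= 1.
Proof.
move=> [q0 q1]; rewrite ger0_norm // -q1 (bigD1 i) //= lerDl.
by apply: sumr_ge0 => j _; exact: q0.
Qed.

Lemma mulmx_simplex_norm_le (R : realType) (K m : nat) (L : 'M[R]_(m, K))
    (q : 'cV[R]_K) i :
  simplex q -> `|(L *m q) i 0| <= \sum_i \sum_j `|L i j|.
Proof.
move=> Sq; apply: (@le_trans _ _ (\sum_j `|L i j|)).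
  rewrite mxE; apply: le_trans (ler_norm_sum _ _ _) _.
  apply: ler_sum => j _; rewrite normrM.
  by apply: ler_piMr => //; exact: simplex_norm_le1.
rewrite [leRHS](bigD1 i) //= lerDl; apply: sumr_ge0 => k _.
by apply: sumr_ge0 => j _.
Qed.

(** The barycenter [c] of the spanning points lies on a segment from any point
    [q] of [C] to some point [r] of their convex hull, with a weight [t > 0] on
    [q] that is the same for all [q]; as [f] is bounded above on the convex hull,
    a very negative value at [q] would contradict the fixed value at [c]. *)
Lemma convex_bounded_below (R : realType) (K : nat) (C : set 'cV[R]_K)
    (f : 'cV[R]_K -> R) :
    C `<=` @simplex R K -> C !=set0 ->
    (forall t a b, 0 <= t <= 1 -> C a -> C b ->
      C (t *: a + (1 - t) *: b) /\
      f (t *: a + (1 - t) *: b) <= t * f a + (1 - t) * f b) ->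
  exists B, forall q, C q -> B <= f q.
Proof.
move=> CS [c0 Cc0] fconv.
have [m [P [L [CP PL]]]] := spanning_points C.
have P1 i : \sum_j P j i = 1.
  by case: (CS _ (CP i)) => _ <-; apply: eq_bigr => j _; rewrite mxE.
have coord1 q : C q -> \sum_i (L *m q) i 0 = 1.
  by move=> Cq; rewrite -(sum_mulmx_col1 _ P1) PL //; case: (CS _ Cq).
have m_ge1 : 1 <= m%:R :> R.
  rewrite ler1n lt0n; apply/eqP => m0; have := coord1 _ Cc0.
  move: (L *m c0); rewrite m0 => a /eqP.
  by rewrite big_ord0 eq_sym oner_eq0.
have Cconv t a b : 0 <= t <= 1 -> C a -> C b -> C (t *: a + (1 - t) *: b).
  by move=> t01 Ca Cb; case: (fconv t a b t01 Ca Cb).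
have ones_ge0 i : 0 <= (const_mx 1 : 'cV[R]_m) i 0 by rewrite mxE.
(* All weights are [1]: [c] is the barycenter of the columns of [P]. *)
have [c Cc] := conic_combination Cconv Cc0 CP ones_ge0.
under eq_bigr do rewrite mxE.
rewrite sumr_const card_ord => Pc.
pose A := \sum_i \sum_j `|L i j|.
have A_ge0 : 0 <= A by apply: sumr_ge0 => i _; exact: sumr_ge0.
(* [M] bounds [f] at the columns of [P], and at the default point [c0] that
   [conic_combination] asks for. *)
pose M := `|f c0| + \sum_i `|f (col i P)|.
have M_ge0 : 0 <= M by apply: addr_ge0 => //; exact: sumr_ge0.
pose s := (A + 1)^-1.
have s_gt0 : 0 < s by rewrite invr_gt0 ltr_wpDl.
have s_le1 : s <= 1 by rewrite invf_le1 ?ltr_wpDl // lerDr.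
pose t := s / m%:R.
have m_gt0 : 0 < m%:R :> R by exact: lt_le_trans m_ge1.
have t_gt0 : 0 < t by exact: divr_gt0.
have t_le1 : t <= 1 by rewrite ler_pdivrMr // mul1r (le_trans s_le1).
have t01 : 0 <= t <= 1 by rewrite (ltW t_gt0).
exists ((f c - M) / t) => q Cq.
pose D := [set r | C r /\ f r <= M].
have Dconv u a b : 0 <= u <= 1 -> D a -> D b -> D (u *: a + (1 - u) *: b).
  move=> u01 [Ca fa] [Cb fb]; have [Cab fab] := fconv u a b u01 Ca Cb.
  by split=> //; apply: le_trans fab _; nra.
have DP i : D (col i P).
  split=> //; apply: le_trans (ler_norm _) _.
  rewrite /M (bigD1 i) //= addrCA lerDl addr_ge0 //.
  exact: sumr_ge0.
have Dc0 : D c0.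
  by split=> //; apply: le_trans (ler_norm _) _; rewrite lerDl; exact: sumr_ge0.
(* The coefficients of [m c - s q]; the choice of [s] makes them nonnegative. *)
pose b : 'cV[R]_m := const_mx 1 - s *: (L *m q).
have b_ge0 i : 0 <= b i 0.
  have : (L *m q) i 0 <= A.
    by apply: le_trans (ler_norm _) _; apply: mulmx_simplex_norm_le; exact: CS.
  have : s * (A + 1) = 1 by rewrite mulVf // gt_eqF // ltr_wpDl.
  rewrite /b; move: (L *m q) => a; rewrite !mxE; nra.
have [r [Cr fr]] := conic_combination Dconv Dc0 DP b_ge0.
have -> : \sum_i b i 0 = m%:R - s.
  under eq_bigr do rewrite !mxE.
  rewrite sumrB sumr_const card_ord; congr (_ - _).
  rewrite -[RHS]mulr1 -(coord1 _ Cq) mulr_sumr.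
  by apply: eq_bigr => i _; rewrite mxE.
rewrite mulmxBr -scalemxAr PL // Pc => cqr.
have cE : c = t *: q + (1 - t) *: r.
  apply: (scalerI (lt0r_neq0 m_gt0)).
  have <- : s *: q + (m%:R - s) *: r = m%:R *: c by rewrite -cqr addrC subrK.
  rewrite scalerDr !scalerA /t; congr (_ *: _ + _ *: _); field;
    exact: lt0r_neq0.
have [_ ] := fconv t q r t01 Cq Cr; rewrite -cE => fc.
rewrite ler_pdivrMr // mulrC; nra.
Qed.

(** * The surplus function *)

Section Surplus.
Variables (R : realType) (K : nat) (Lambda : 'cV[R]_K -> \bar R).
Hypothesis Lambda_reg : convex_regularizer Lambda.

Let dom := [set q | simplex q /\ Lambda q != +oo%E].
Let lambda q := fine (Lambda q).

Lemma LambdaE q : dom q -> Lambda q = (lambda q)%:E.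
Proof.
case: Lambda_reg => Nninf _ _ [Sq qp]; rewrite fineK // fin_numE.
by rewrite qp Nninf.
Qed.

Lemma convex_dom t a b : 0 <= t <= 1 -> dom a -> dom b ->
  dom (t *: a + (1 - t) *: b) /\
  lambda (t *: a + (1 - t) *: b) <= t * lambda a + (1 - t) * lambda b.
Proof.
move=> /andP[t0 t1] da db; have [_ _ Lconv] := Lambda_reg.
have t'0 : 0 <= 1 - t by rewrite subr_ge0.
have Sab : simplex (t *: a + (1 - t) *: b).
  case: da db => -[a0 a1] _ [[b0 b1] _]; split=> [i|].
    by rewrite !mxE addr_ge0 // mulr_ge0.
  under eq_bigr do rewrite !mxE.
  by rewrite big_split /= -!mulr_sumr a1 b1 !mulr1 addrC subrK.
have := Lconv (Itv01 t0 t1) a b; rewrite !inE => /(_ da.1 db.1).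
have -> : conv (Itv01 t0 t1) (a : convex_lmodType 'cV[R]_K) b
          = t *: a + (1 - t) *: b by [].
rewrite (LambdaE da) (LambdaE db) -!EFinM -EFinD /= => Lab.
have dab : dom (t *: a + (1 - t) *: b).
  by split=> //; apply/eqP => Lp; move: Lab; rewrite Lp leye_eq.
by split=> //; rewrite -lee_fin -LambdaE.
Qed.

(** Points where [Lambda] is [+oo] contribute [-oo] to the supremum, which leaves
    a family of real affine functions of [V]. *)
Lemma surplus_leP V z :
  (surplus Lambda V <= z%:E)%E <-> forall q, dom q -> dot q V - lambda q <= z.
Proof.
split=> [/ereal_supP le_z q dq|le_z].
  by rewrite -lee_fin EFinB -LambdaE //; apply: le_z; exists q => //; case: dq.
apply/ereal_supP => _ [q Sq <-].
have [->|Lq] := eqVneq (Lambda q) +oo%E; first by rewrite addeNy leNye.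
have dq : dom q by [].
by rewrite LambdaE // -EFinB lee_fin; exact: le_z.
Qed.

Lemma surplus_fin_num V : surplus Lambda V \is a fin_num.
Proof.
have [_ [q0 Sq0 Lq0] _] := Lambda_reg.
have dq0 : dom q0 by [].
have [B lbB] : exists B, forall q, dom q -> B <= lambda q.
  apply: (@convex_bounded_below _ _ dom); [by move=> q [] | by exists q0|].
  exact: convex_dom.
apply: fin_real; apply/andP; split.
  apply: (@lt_le_trans _ _ (dot q0 V - lambda q0)%:E); first exact: ltNyr.
  by rewrite EFinB -LambdaE //; apply: ereal_sup_ubound; exists q0.
apply: (@le_lt_trans _ _ (\sum_i `|V i 0| - B)%:E); last exact: ltry.
apply/surplus_leP => q dq; apply: lerB; last exact: lbB.
apply: le_trans (ler_norm _) _; rewrite /dot mxE.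
apply: le_trans (ler_norm_sum _ _ _) _; apply: ler_sum => i _.
rewrite normrM mxE; apply: ler_piMl => //.
by apply: simplex_norm_le1; case: dq.
Qed.

Lemma surplus_convex t V W : 0 <= t <= 1 ->
  fine (surplus Lambda (t *: V + (1 - t) *: W))
  <= t * fine (surplus Lambda V) + (1 - t) * fine (surplus Lambda W).
Proof.
move=> /andP[t0 t1].
have ub U q : dom q -> dot q U - lambda q <= fine (surplus Lambda U).
  by move: q; apply/surplus_leP; rewrite fineK // surplus_fin_num.
rewrite -lee_fin fineK ?surplus_fin_num //; apply/surplus_leP => q dq.
have := ub V q dq; have := ub W q dq.
rewrite /dot mulmxDr -!scalemxAr.
move: (q^T *m V) (q^T *m W) => v w; rewrite !mxE; nra.
Qed.

End Surplus.

(** * The estimation objective *)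

Lemma utility_conv (R : realType) (d K : nat) (x : 'I_K -> 'cV[R]_d)
    (t u : R) (a b : 'cV[R]_d) :
  utility x (t *: a + u *: b) = t *: utility x a + u *: utility x b.
Proof.
apply/colP => k; rewrite !mxE /dot linearD !linearZ /= mulmxDl.
by rewrite -!scalemxAl !mxE.
Qed.

Lemma dot_conv (R : realType) (m : nat) (y : 'cV[R]_m) (t u : R) a b :
  dot y (t *: a + u *: b) = t * dot y a + u * dot y b.
Proof. by rewrite /dot mulmxDr -!scalemxAr !mxE. Qed.

Lemma FY_objectiveE (R : realType) (d K N : nat)
    (Lambda : 'cV[R]_K -> \bar R) (Lambda_reg : convex_regularizer Lambda)
    (x : 'I_N -> 'I_K -> 'cV[R]_d) (y : 'I_N -> 'cV[R]_K) (beta : 'cV[R]_d) :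
  FY_objective Lambda x y beta =
  (N%:R^-1 * \sum_(n < N) (fine (surplus Lambda (utility (x n) beta))
                           - dot (y n) (utility (x n) beta)))%:E.
Proof.
rewrite /FY_objective EFinM -sumEFin; congr (_ * _)%E.
by apply: eq_bigr => n _; rewrite EFinB fineK // surplus_fin_num.
Qed.

Theorem proposition4 (R : realType) (d K N : nat) (N_gt0 : (0 < N)%N)
    (Lambda : 'cV[R]_K -> \bar R) (Lambda_reg : convex_regularizer Lambda)
    (x : 'I_N -> 'I_K -> 'cV[R]_d) (y : 'I_N -> 'cV[R]_K)
    (y_one_hot : forall n, one_hot (y n)) :
  (forall beta : 'cV[R]_d, FY_objective Lambda x y beta \is a fin_num) /\
  convex_function (setT : set (convex_lmodType 'cV[R]_d))
    (fun beta => fine (FY_objective Lambda x y beta)).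
Proof.
split=> [beta|t a b _ _]; first by rewrite FY_objectiveE.
rewrite convRE !FY_objectiveE //=.
have -> : conv t a b = t%:num *: (a : 'cV[R]_d) + (1 - t%:num) *: (b : 'cV[R]_d).
  by [].
have t01 : 0 <= t%:num <= 1 by apply/andP.
rewrite mulrCA [X in _ <= _ + X]mulrCA -mulrDr ler_wpM2l ?invr_ge0 //.
rewrite !mulr_sumr -big_split /=; apply: ler_sum => n _.
rewrite utility_conv dot_conv.
have := surplus_convex Lambda_reg (utility (x n) a) (utility (x n) b) t01.
rewrite /unstable.onem; lra.
Qed.
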